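(* Let $f:\mathbb{R}^m\times\mathbb{R}^n\to\mathbb{R}$ be twice continuously differentiable, let $F(x,y)=(\nabla_xf(x,y),-\nabla_yf(x,y))$, let $\alpha\in\mathbb{R}$, $\eta>0$ and $z_a\in\mathbb{R}^m\times\mathbb{R}^n$. For $h=(h_x,h_y)\in\mathbb{R}^m\times\mathbb{R}^n$ set $$\Phi_\alpha(h,z_a)=F(z_a)+\frac{\alpha}{\eta}\bigl(\nabla_{xy}f(z_a)h_y,\,-\nabla_{yx}f(z_a)h_x\bigr)+\frac1\eta h .$$ Then, as operators in the variable $h$, $\Phi_\alpha(\cdot,z_a)$ is $1$-relatively smooth and $1$-relatively strongly monotone with respect to $\Phi_0(\cdot,z_a)$, where $\Phi_0(h,z_a)=F(z_a)+\frac1\eta h$. Furthermore, $\Phi_0(\cdot,z_a)$ is monotone.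
   Context: $\nabla_{xy}f(z_a)$ is the $m\times n$ matrix of mixed second partial derivatives $\partial^2f/\partial x_i\partial y_j$ at $z_a$, and $\nabla_{yx}f(z_a)$ is the $n\times m$ matrix of $\partial^2f/\partial y_j\partial x_i$. For operators $G,H$ on a Euclidean space: $G$ is monotone if $\langle G(h_2)-G(h_1),h_2-h_1\rangle\ge0$ for all $h_1,h_2$. $G$ is $L$-relatively smooth with respect to $H$ if $L\langle H(h_2)-H(h_1),h_2-h_1\rangle\ge\langle G(h_2)-G(h_1),h_2-h_1\rangle$ for all $h_1,h_2$. $G$ is $\mu$-relatively strongly monotone with respect to $H$ if $\langle G(h_2)-G(h_1),h_2-h_1\rangle\ge\mu\langle H(h_2)-H(h_1),h_2-h_1\rangle$ for all $h_1,h_2$. *)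

(* Defs.v *)
From HB Require Import structures.
From mathcomp Require Import all_boot all_order all_algebra.
From mathcomp Require Import all_classical all_reals all_analysis.
Set Implicit Arguments.
Unset Strict Implicit.
Unset Printing Implicit Defensive.
Import Order.TTheory GRing.Theory Num.Theory.
Import numFieldNormedType.Exports.
Local Open Scope classical_set_scope.
Local Open Scope ring_scope.

Section Defs.
Variables (R : realType) (m n : nat).

(* R^m x R^n, with the product of the sup-norm topologies (hence the usual
   topology); the Euclidean structure is the inner product [dot] below. *)
Local Notation E := ('cV[R]_m * 'cV[R]_n)%type.

Implicit Types (f g : E -> R) (z h : E) (G H : E -> E).

Definition basis_x (i : 'I_m) : E := (delta_mx i 0, 0).
Definition basis_y (j : 'I_n) : E := (0, delta_mx j 0).

Definition cont_partial (e : E) g :=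
  (forall z, derivable g z e) /\ continuous (fun z => 'D_e g z).

(* In finite dimension, continuous partials are equivalent to Frechet C^1. *)
Definition C1 g :=
  (forall i, cont_partial (basis_x i) g) /\ (forall j, cont_partial (basis_y j) g).

Definition C2 f :=
  [/\ C1 f, (forall i, C1 (fun z => 'D_(basis_x i) f z)) &
      (forall j, C1 (fun z => 'D_(basis_y j) f z))].

Definition grad_x f z : 'cV[R]_m := \col_i 'D_(basis_x i) f z.
Definition grad_y f z : 'cV[R]_n := \col_j 'D_(basis_y j) f z.

(* (i, j) entry: d^2 f / dx_i dy_j = d/dx_i (d f / dy_j). *)
Definition hess_xy f z : 'M[R]_(m, n) :=
  \matrix_(i, j) 'D_(basis_x i) (fun w => 'D_(basis_y j) f w) z.

(* (j, i) entry: d^2 f / dy_j dx_i = d/dy_j (d f / dx_i). *)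
Definition hess_yx f z : 'M[R]_(n, m) :=
  \matrix_(j, i) 'D_(basis_y j) (fun w => 'D_(basis_x i) f w) z.

Definition F f z : E := (grad_x f z, - grad_y f z).

Definition Phi f (eta alpha : R) h z : E :=
  F f z + (alpha / eta) *: ((hess_xy f z *m h.2, - (hess_yx f z *m h.1)) : E)
  + eta^-1 *: h.

Definition dot z h : R :=
  \sum_i z.1 i 0 * h.1 i 0 + \sum_j z.2 j 0 * h.2 j 0.

Definition monotone_op G :=
  forall h1 h2, 0 <= dot (G h2 - G h1) (h2 - h1).

Definition rel_smooth (L : R) G H :=
  forall h1 h2,
    dot (G h2 - G h1) (h2 - h1) <= L * dot (H h2 - H h1) (h2 - h1).

Definition rel_strongly_monotone (mu : R) G H :=
  forall h1 h2,
    mu * dot (H h2 - H h1) (h2 - h1) <= dot (G h2 - G h1) (h2 - h1).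

End Defs.

(* Main.v *)
Require Import Defs.
From HB Require Import structures.
From mathcomp Require Import all_boot all_order all_algebra.
From mathcomp Require Import all_classical all_reals all_analysis.
From mathcomp Require Import ring.
Import Order.TTheory GRing.Theory Num.Theory.
Import numFieldNormedType.Exports.
Local Open Scope ring_scope.

(** The increment of [Phi f eta alpha] between [h1] and [h2] is
    [(alpha / eta) *: J d + eta^-1 *: d] with [d = h2 - h1] and
    [J d = (A *m d.2, - (B *m d.1))], where [A] and [B] are the two matrices of
    mixed second derivatives at [za].  Equality of mixed partial derivatives
    makes [B] the transpose of [A], so [J] is skew-symmetric and
    [dot (J d) d = 0] ([dot_skew]).  The term in [alpha] therefore contributes
    nothing: for every [alpha] the pairing of the increment with [d] is
    [eta^-1 * dot d d] ([dot_Phi_increment]).  Both relative inequalities hold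
    with equality, and monotonicity is the nonnegativity of [dot d d].

    The analytic ingredient is the theorem of Schwarz ([mixed_derive_sym]),
    proved for directional derivatives along two vectors [u], [v] of a normed
    space.  The second difference of [f] over the parallelogram with vertex [z]
    and sides [s *: u], [s *: v] is symmetric in [u] and [v], and two uses of
    the mean value theorem express it as [s ^+ 2] times a mixed derivative at
    some point of the parallelogram, with the derivatives in either order.
    As [s] tends to [0], continuity of both mixed derivatives at [z] identifies
    their values there. *)

Section MixedDerivatives.
Variables (R : realType) (V : normedModType R).
Implicit Types (f : V -> R) (u v w z : V).

Lemma is_derive_along_line f u z (t : R) :
  derivable f (z + t *: u) u ->
  is_derive t (1 : R) (fun s : R => f (z + s *: u)) ('D_u f (z + t *: u)).
Proof.
(* Both difference quotients are the same function of the step. *)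
have E : (fun h : R => h^-1 *: (((fun s : R => f (z + s *: u)) \o shift t)
            (h *: (1 : R)) - f (z + t *: u))) =
         (fun h : R => h^-1 *: ((f \o shift (z + t *: u)) (h *: u)
            - f (z + t *: u))).
  apply/funext => h /=.
  by rewrite [h *: 1]mulr1 scalerDl addrCA.
move=> df; apply: DeriveDef; first by rewrite /derivable E.
by rewrite /derive E.
Qed.

Lemma is_derive_shift f u w z :
  derivable f (z + w) u -> is_derive z u (fun y => f (y + w)) ('D_u f (z + w)).
Proof.
have E : (fun h : R => h^-1 *: (((fun y => f (y + w)) \o shift z) (h *: u)
            - f (z + w))) =
         (fun h : R => h^-1 *: ((f \o shift (z + w)) (h *: u) - f (z + w))).
  by apply/funext => h /=; rewrite addrA.
move=> df; apply: DeriveDef; first by rewrite /derivable E.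
by rewrite /derive E.
Qed.

Lemma MVT_along_line f u z (s : R) : 0 < s -> (forall w, derivable f w u) ->
  exists2 c, c \in `]0, s[%R & f (z + s *: u) - f z = 'D_u f (z + c *: u) * s.
Proof.
move=> s0 df.
have dg (t : R) := @is_derive_along_line f u z t (df _).
have [|c cs] := @MVT R (fun t => f (z + t *: u)) _ 0 s s0 (fun t _ => dg t).
  apply: continuous_subspaceT => t.
  apply: differentiable_continuous; apply/derivable1_diffP.
  exact: (@ex_derive _ _ _ _ _ _ _ (dg t)).
by rewrite scale0r addr0 subr0; exists c.
Qed.

(** The mean value theorem is used first along [u], on the increment
    [w |-> f (w + s *: v) - f w], then along [v], on ['D_u f]. *)
Lemma second_difference_MVT f u v z (s : R) : 0 < s ->
  (forall w, derivable f w u) ->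
  (forall w, derivable (fun y => 'D_u f y) w v) ->
  exists a b, [/\ a \in `]0, s[%R, b \in `]0, s[%R &
    f (z + s *: u + s *: v) - f (z + s *: u) - (f (z + s *: v) - f z) =
    'D_v (fun y => 'D_u f y) (z + a *: u + b *: v) * s ^+ 2].
Proof.
move=> s0 df ddf.
have dg w : is_derive w u (fun y => f (y + s *: v) - f y)
    ('D_u f (w + s *: v) - 'D_u f w).
  apply: is_deriveB; first exact: is_derive_shift.
  exact: derivableP.
have [a as0 Ea] := @MVT_along_line (fun y => f (y + s *: v) - f y) u z s s0
  (fun w => @ex_derive _ _ _ _ _ _ _ (dg w)).
have [b bs0 Eb] := @MVT_along_line _ v (z + a *: u) s s0 ddf.
exists a, b; split=> //.
by rewrite Ea (@derive_val _ _ _ _ _ _ _ (dg _)) Eb expr2 mulrA.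
Qed.

Lemma near_small_parallelogram u v z (P : V -> Prop) :
  (\forall w \near z, P w) ->
  exists2 s : R, 0 < s & forall a b, a \in `]0, s[%R -> b \in `]0, s[%R ->
    P (z + a *: u + b *: v).
Proof.
move=> /nbhs_ballP[e /= e0 He].
have N0 : 0 < `|u| + `|v| + 1 by rewrite ltr_wpDl// addr_ge0.
exists (e / (`|u| + `|v| + 1)); first exact: divr_gt0.
set s := e / _ => a b; rewrite !in_itv/= => /andP[a0 ls] /andP[b0 bs].
have s0 : 0 < s by rewrite (lt_trans a0).
apply: He; rewrite -ball_normE /= -addrA opprD addNKr normrN.
have -> : e = s * (`|u| + `|v|) + s by rewrite -[X in _ + X]mulr1 -mulrDr divfK// gt_eqF.
rewrite ltr_pwDr// (le_trans (ler_normD _ _))// !normrZ !gtr0_norm// mulrDr.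
by rewrite lerD// ler_wpM2r// ltW.
Qed.

(** Schwarz's theorem, in the form where both mixed derivatives exist everywhere
    and are continuous at the point considered. *)
Theorem mixed_derive_sym f u v z :
  (forall w, derivable f w u) -> (forall w, derivable f w v) ->
  (forall w, derivable (fun y => 'D_u f y) w v) ->
  (forall w, derivable (fun y => 'D_v f y) w u) ->
  {for z, continuous (fun y => 'D_v (fun w => 'D_u f w) y)} ->
  {for z, continuous (fun y => 'D_u (fun w => 'D_v f w) y)} ->
  'D_v (fun w => 'D_u f w) z = 'D_u (fun w => 'D_v f w) z.
Proof.
move=> du dv dvu duv cvu cuv.
apply/eqP; rewrite -subr_eq0 -normr_le0; apply/ler_addgt0Pl => e e0.
rewrite addr0.
have e20 : 0 < e / 2 by rewrite divr_gt0.
have nvu := (@cvgrPdist_lt _ _ _ _ _ _ _).1 cvu _ e20.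
have nuv := (@cvgrPdist_lt _ _ _ _ _ _ _).1 cuv _ e20.
have [s1 s10 H1] := near_small_parallelogram u v z _ (nvu _).
have [s2 s20 H2] := near_small_parallelogram u v z _ (nuv _).
pose s := Num.min s1 s2.
have s0 : 0 < s by rewrite lt_min s10.
have ss1 c : c \in `]0, s[%R -> c \in `]0, s1[%R.
  by rewrite !in_itv/= lt_min => /and3P[-> ->].
have ss2 c : c \in `]0, s[%R -> c \in `]0, s2[%R.
  by rewrite !in_itv/= lt_min => /and3P[-> _ ->].
have [a [b [as0 bs0 E1]]] := second_difference_MVT f u v z s s0 du dvu.
have [b' [a' [bs0' as0' E2]]] := second_difference_MVT f v u z s s0 dv duv.
have E : 'D_v (fun w => 'D_u f w) (z + a *: u + b *: v) =
         'D_u (fun w => 'D_v f w) (z + a' *: u + b' *: v).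
  (* Multiplied by [s ^+ 2], both sides are the same second difference. *)
  have s2n0 : s ^+ 2 != 0 by rewrite expf_neq0// gt_eqF.
  apply: (mulIf s2n0); rewrite [z + a' *: u + _]addrAC.
  apply: etrans (esym E1) (etrans _ E2).
  by rewrite [z + s *: v + _]addrAC; ring.
have := H2 _ _ (ss2 _ as0') (ss2 _ bs0'); rewrite -E distrC => {}H2.
rewrite (splitr e); apply: le_trans (ler_distD _ _ _) (lerD _ (ltW H2)).
exact: ltW (H1 _ _ (ss1 _ as0) (ss1 _ bs0)).
Qed.

End MixedDerivatives.

Section Linearization.
Variables (R : realType) (m n : nat).
Local Notation E := ('cV[R]_m * 'cV[R]_n)%type.
Implicit Types (f : E -> R) (d h z : E).

Lemma hess_yx_tr f z : C2 f -> hess_yx f z = (hess_xy f z)^T.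
Proof.
case=> -[fx fy] fxC fyC; apply/matrixP => j i; rewrite !mxE.
have [_ /(_ j)[dyx cyx]] := fxC i.
have [/(_ i)[dxy cxy] _] := fyC j.
exact: (@mixed_derive_sym R E f (basis_x R n i) (basis_y R m j) z
  (fx i).1 (fy j).1 dyx dxy (cyx z) (cxy z)).
Qed.

Lemma dotDl h1 h2 d : dot (h1 + h2) d = dot h1 d + dot h2 d.
Proof.
rewrite /dot addrACA -!big_split/=.
by congr (_ + _); apply: eq_bigr => i _; rewrite mxE mulrDl.
Qed.

Lemma dotZl (c : R) h d : dot (c *: h) d = c * dot h d.
Proof.
rewrite /dot mulrDr !mulr_sumr.
by congr (_ + _); apply: eq_bigr => i _; rewrite mxE mulrA.
Qed.

Lemma dot_ge0 d : 0 <= dot d d.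
Proof. by rewrite addr_ge0// sumr_ge0// => i _; rewrite -expr2 sqr_ge0. Qed.

Lemma dot_skew (A : 'M[R]_(m, n)) d : dot (A *m d.2, - (A^T *m d.1)) d = 0.
Proof.
rewrite /dot /=; apply/eqP; rewrite addr_eq0 -sumrN; apply/eqP.
under eq_bigr do rewrite mxE mulr_suml.
rewrite exchange_big; apply: eq_bigr => j _ /=.
rewrite !mxE mulNr opprK mulr_suml; apply: eq_bigr => i _.
by rewrite mxE mulrAC.
Qed.

Lemma Phi_increment f (eta alpha : R) h1 h2 z :
  Phi f eta alpha h2 z - Phi f eta alpha h1 z =
  (alpha / eta) *: ((hess_xy f z *m (h2 - h1).2,
                     - (hess_yx f z *m (h2 - h1).1)) : E)
  + eta^-1 *: (h2 - h1).
Proof.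
rewrite /Phi opprD addrACA -scalerBr opprD addrACA subrr add0r -scalerBr.
congr (_ *: _ + _); congr (_, _) => /=; first by rewrite mulmxBr.
by rewrite mulmxBr opprB opprK addrC.
Qed.

(** The value is independent of [alpha] because the coupling of the two blocks
    is skew-symmetric. *)
Lemma dot_Phi_increment f (eta alpha : R) h1 h2 z : C2 f ->
  dot (Phi f eta alpha h2 z - Phi f eta alpha h1 z) (h2 - h1) =
  eta^-1 * dot (h2 - h1) (h2 - h1).
Proof.
move=> fC2; rewrite Phi_increment hess_yx_tr//.
apply: etrans (dotDl _ _ _) _.
by rewrite !dotZl dot_skew mulr0 add0r.
Qed.

End Linearization.

Theorem lemma4p5 (R : realType) (m n : nat)
    (f : 'cV[R]_m * 'cV[R]_n -> R) (alpha eta : R)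
    (za : 'cV[R]_m * 'cV[R]_n) :
  C2 f -> 0 < eta ->
  [/\ rel_smooth 1 (fun h => Phi f eta alpha h za)
        (fun h => Phi f eta 0 h za),
      rel_strongly_monotone 1 (fun h => Phi f eta alpha h za)
        (fun h => Phi f eta 0 h za),
      (forall h, Phi f eta 0 h za = F f za + eta^-1 *: h) &
      monotone_op (fun h => Phi f eta 0 h za)].
Proof.
move=> fC2 eta0; split=> [h1 h2|h1 h2|h|h1 h2].
- by rewrite mul1r !dot_Phi_increment.
- by rewrite mul1r !dot_Phi_increment.
- by rewrite /Phi mul0r scale0r addr0.
- by rewrite dot_Phi_increment// mulr_ge0 ?dot_ge0// invr_ge0 ltW.
Qed.
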